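(* Let $\varphi$ be any given measurable real-valued function on $(S,\mathcal{S})$ and $N>0$ an integer. Then $\mu^N_\times(\varphi)$ is a minimum variance unbiased estimator for $\mu(\varphi)$ in the following sense: if $f$ is a measurable real-valued function on $(S^N,\mathcal{S}^N)$ such that $$\mathbb{E}[f(X^1,\dots,X^N)]=\mu(\varphi)\quad\text{with }X^1,\dots,X^N\sim\mu\text{ i.i.d.}$$ for all product-form probability distributions $\mu$ on $(S,\mathcal{S})$ satisfying $\mu(|\varphi|)<\infty$, then, for all such $\mu$, $$\mathrm{Var}(f(X^1,\dots,X^N))\geq\mathrm{Var}(\mu^N_\times(\varphi)).$$
   Context: $K>1$ is an integer; $(S_1,\mathcal{S}_1),\dots,(S_K,\mathcal{S}_K)$ are fixed measurable spaces, $S:=S_1\times\dots\times S_K$ with product sigma-algebra $\mathcal{S}$; $\mathcal{S}^N$ is the product sigma-algebra on $S^N$. A probability distribution $\mu$ on $(S,\mathcal{S})$ is product-form if $\mu=\mu_1\times\dots\times\mu_K$ for probability distributions $\mu_k$ on $(S_k,\mathcal{S}_k)$. $\mu(\varphi):=\int\varphi\,d\mu$. Given $X^n=(X^n_1,\dots,X^n_K)$, $n=1,\dots,N$, i.i.d. with law $\mu$, the product-form estimator is $\mu^N_\times(\varphi):=N^{-K}\sum_{\mathbf{n}\in[N]^K}\varphi(X^{\mathbf{n}})$, where $[N]:=\{1,\dots,N\}$ and $X^{\mathbf{n}}:=(X^{n_1}_1,\dots,X^{n_K}_K)$ for $\mathbf{n}=(n_1,\dots,n_K)$. The unbiasedness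 hypothesis on $f$ includes that the expectation exists; variances may be $+\infty$. *)

(* Defs.v *)
From HB Require Import structures.
From mathcomp Require Import all_boot all_order all_algebra.
From mathcomp Require Import all_classical all_reals all_analysis.

Set Implicit Arguments.
Unset Strict Implicit.
Unset Printing Implicit Defensive.

Import Order.TTheory GRing.Theory Num.Theory.

Local Open Scope classical_set_scope.
Local Open Scope ring_scope.

(* S_0 x ... x S_(n-1). The library only has binary products and powers
   (n.-tuple T) of measurable spaces, hence the heterogeneous n-fold product
   below. *)
Definition pi_space (n : nat) (S : 'I_n -> Type) : Type := forall k, S k.

HB.instance Definition _ (n : nat) (S : 'I_n -> pointedType) :=
  Pointed.copy (pi_space S) (forall k, S k).

Definition pi_display (n : nat) : ('I_n -> measure_display) -> measure_display.
Proof. by move=> _; exact: default_measure_display. Qed.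

(* The product sigma-algebra: generated by the cylinders
   [set x | A (x k)], A measurable in S k. *)
Definition pi_measurable (n : nat) (d : 'I_n -> measure_display)
    (S : forall k, measurableType (d k)) : set (set (pi_space S)) :=
  <<s \bigcup_(k : 'I_n)
        preimage_set_system setT (fun x : pi_space S => x k) measurable >>.

HB.instance Definition _ (n : nat) (d : 'I_n -> measure_display)
    (S : forall k, measurableType (d k)) :=
  @isMeasurable.Build (pi_display d) (pi_space S) (pi_measurable (S := S))
    (@sigma_algebra0 _ _ _) (@sigma_algebraC _ _)
    (@sigma_algebra_bigcup _ _ _).

(* mu = mu_0 x ... x mu_(K-1). Measurable rectangles form a generating
   pi-system, so they determine the product measure. *)
Definition product_form (R : realType) (K : nat) (d : 'I_K -> measure_display)
    (S : forall k, measurableType (d k)) (mu : probability (pi_space S) R) :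
    Prop :=
  exists mu_ : forall k, probability (S k) R,
    forall A : (forall k, set (S k)), (forall k, measurable (A k)) ->
      mu [set x | forall k, A k (x k)] = (\prod_(k < K) mu_ k (A k))%E.

Definition mutually_independent (R : realType) (dO : measure_display)
    (Omega : measurableType dO) (P : probability Omega R)
    (dT : measure_display) (T : measurableType dT) (N : nat)
    (X : 'I_N -> {RV P >-> T}) : Prop :=
  forall (J : {set 'I_N}) (A : 'I_N -> set T), (forall n, measurable (A n)) ->
    P (\bigcap_(n in [set` J]) (X n @^-1` A n))
      = (\prod_(n in J) P (X n @^-1` A n))%E.

Definition iid (R : realType) (dO : measure_display)
    (Omega : measurableType dO) (P : probability Omega R)
    (dT : measure_display) (T : measurableType dT) (N : nat)
    (X : 'I_N -> {RV P >-> T}) (mu : probability T R) : Prop :=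
  mutually_independent X /\
  forall (n : 'I_N) (A : set T), measurable A -> distribution P (X n) A = mu A.

Definition sample (R : realType) (dO : measure_display)
    (Omega : measurableType dO) (P : probability Omega R)
    (dT : measure_display) (T : measurableType dT) (N : nat)
    (X : 'I_N -> {RV P >-> T}) (w : Omega) : N.-tuple T :=
  [tuple X n w | n < N].

(* x^n := (x^(n_1)_1, ..., x^(n_K)_K) takes its k-th coordinate from the
   n_k-th sample point. *)
Definition recombine (K N : nat) (d : 'I_K -> measure_display)
    (S : forall k, measurableType (d k)) (x : N.-tuple (pi_space S))
    (n : {ffun 'I_K -> 'I_N}) : pi_space S :=
  fun k => tnth x (n k) k.

Definition product_form_estimator (R : realType) (K N : nat)
    (d : 'I_K -> measure_display) (S : forall k, measurableType (d k))
    (phi : pi_space S -> R) (x : N.-tuple (pi_space S)) : R :=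
  (N%:R ^+ K)^-1 * \sum_(n : {ffun 'I_K -> 'I_N}) phi (recombine x n).

(* Main.v *)
Require Import Defs.
From HB Require Import structures.
From mathcomp Require Import all_boot all_order all_algebra.
From mathcomp Require Import all_classical all_reals all_analysis.
From mathcomp Require Import measurable_realfun lra.
Import Order.TTheory GRing.Theory Num.Theory.

Set Implicit Arguments.
Unset Strict Implicit.
Unset Printing Implicit Defensive.

Local Open Scope classical_set_scope.
Local Open Scope ring_scope.

(** The idea is Halmos's symmetrisation argument for U-statistics, applied to
    K groups of permutations at once.  Let the group of K-tuples of permutations
    of the N sample indices act on samples by shuffling every coordinate
    separately.  Under a product-form law an i.i.d. sample has independent
    coordinates, so its distribution is invariant under this action
    ([resample_law]), and averaging a statistic over the group preserves its mean
    and, by Jensen's inequality for the square, does not increase its variance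
    ([variance_average_le]).

    It remains to see that the group average of an unbiased [f] is the
    product-form estimator, pointwise ([estimator_is_average]).  Fix a sample [x]
    and a nonempty set of indices [J k] for each coordinate [k].  The law which
    is uniform on the grid of points with k-th coordinate among the
    k-th coordinates of the sample points with index in [J k] is of product form
    and integrates everything, so [f] and the estimator have the same mean under
    it: the sum of [f - estimator] over all index arrays with values in the sets
    [J k] vanishes.  An inclusion-exclusion over the family [J]
    ([sum_column_bijective]) isolates from these identities the arrays in which
    every coordinate is permuted.  Hence [f] and the estimator have the same
    group average, and the estimator is its own ([estimator_resample]). *)

(** * Inclusion-exclusion over boxes of index arrays *)

(** Toggling the membership of a point outside [A] is a sign-reversing
    involution on the supersets of [A]. *)
Lemma sum_sign_supersets (R : comNzRingType) (M : finType) (A : {set M}) :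
  \sum_(B : {set M} | A \subset B) (-1) ^+ #|B|
    = if A == finset.setT then (-1) ^+ #|M| else 0 :> R.
Proof.
case: (eqVneq A finset.setT) => [->|/eqP AT].
  rewrite (eq_bigl (pred1 finset.setT)) ?big_pred1_eq ?cardsT// => B /=.
  by rewrite finset.subTset.
have [a aA] : exists a, a \notin A.
  apply/existsP; rewrite -negb_forall; apply/negP => /forallP AE.
  by apply: AT; apply/setP => x; rewrite finset.in_setT AE.
rewrite (bigID (fun B : {set M} => a \in B)) /=.
rewrite (reindex_onto (fun B => a |: B)%SET (fun B => B :\ a)%SET) /=; last first.
  by move=> B /andP[_ aB]; rewrite finset.setD1K.
rewrite (eq_bigl (fun B : {set M} => (A \subset B) && (a \notin B))); last first.
  move=> B; rewrite setU11 andbT.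
  have -> : ((a |: B) :\ a == B)%SET = (a \notin B).
    by apply/eqP/idP => [<-|/finset.setU1K//]; rewrite !inE eqxx.
  congr (_ && _); apply/fintype.subsetP/fintype.subsetP => AB x xA.
    have := AB x xA; rewrite in_setU1 => /orP[/eqP xa|//].
    by rewrite -xa xA in aA.
  by rewrite in_setU1 AB// orbT.
rewrite -big_split/= big1// => B /andP[_ aB].
by rewrite cardsU1 aB exprS mulN1r addNr.
Qed.

(** Such an array encodes a K-tuple of permutations of the finite type [M]: as
    [M] is finite, injectivity of each column is bijectivity. *)
Definition column_bijective (I M : finType) (w : {ffun M -> {ffun I -> M}}) :=
  [forall k, injectiveb (fun n => w n k)].

Lemma column_bijective_gt0 (I M : finType) : (0 < #|@column_bijective I M|)%N.
Proof.
apply/card_gt0P; exists [ffun n => [ffun=> n]]; apply/forallP => k.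
by apply/injectiveP => n n'; rewrite !ffunE.
Qed.

(** Sum the hypothesis over all [J] with the sign of [\prod_k (-1) ^+ #|J k|].
    An array [w] is counted by those [J] that contain its column images, so by
    [sum_sign_supersets] only arrays with surjective columns survive, all with
    the same sign. *)
Lemma sum_column_bijective (R : comNzRingType) (I M : finType)
    (h : {ffun M -> {ffun I -> M}} -> R) :
  (0 < #|M|)%N ->
  (forall J : {ffun I -> {set M}}, (forall k, J k != finset.set0) ->
    \sum_(w : {ffun M -> {ffun I -> M}} | [forall n, forall k, w n k \in J k]) h w = 0) ->
  \sum_(w | column_bijective w) h w = 0.
Proof.
move=> M0 hJ.
have [m _] : exists m : M, true by move/card_gt0P: M0 => [m _]; exists m.
(* A box with an empty side contains no array, because [M] is not empty. *)
have {}hJ (J : {ffun I -> {set M}}) :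
    \sum_(w : {ffun M -> {ffun I -> M}} | [forall n, forall k, w n k \in J k]) h w = 0.
  have [J0|] := boolP [forall k, J k != finset.set0].
    by apply: hJ => k; apply/forallP : k.
  rewrite negb_forall => /existsP[k]; rewrite negbK => /eqP Jk.
  rewrite big_pred0// => w; apply/negbTE/negP => /forallP/(_ m)/forallP/(_ k).
  by rewrite Jk inE.
pose img (w : {ffun M -> {ffun I -> M}}) k := [set w n k | n in M]%SET.
have boxE (w : {ffun M -> {ffun I -> M}}) (J : {ffun I -> {set M}}) :
    [forall n, forall k, w n k \in J k] = (J \in family (fun k (B : {set M}) => img w k \subset B)).
  apply/forallP/familyP => [wJ k|wJ n].
    by apply/fintype.subsetP => _ /imsetP[n _ ->]; have /forallP := wJ n; exact.
  apply/forallP => k; have /fintype.subsetP := wJ k.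
  by apply; apply/imsetP; exists n.
have bijE (w : {ffun M -> {ffun I -> M}}) : column_bijective w = [forall k, img w k == finset.setT].
  apply: eq_forallb => k; apply/injectiveP/eqP => [inj|im].
    by apply/eqP; rewrite eqEcard finset.subsetT cardsT card_imset//= leqnn.
  have /imset_injP inj : #|img w k| == #|M| by rewrite im cardsT.
  by move=> n n' /= eqw; apply: inj.
have sgn2 : (\prod_(k : I) (-1) ^+ #|M|) * (\prod_(k : I) (-1) ^+ #|M|) = 1 :> R.
  by rewrite -big_split/= big1// => k _; rewrite -exprMn mulrNN mulr1 expr1n.
rewrite -[LHS]mulr1 -sgn2 mulrA [X in X * _](_ : _ = 0) ?mul0r//.
transitivity (\sum_w h w * \prod_k \sum_(B : {set M} | img w k \subset B) (-1) ^+ #|B|).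
  rewrite big_distrl/= big_mkcond/=; apply: eq_bigr => w _.
  under [in RHS]eq_bigr do rewrite sum_sign_supersets.
  rewrite bijE; case: ifPn => [/forallP all_T|].
    by congr (_ * _); apply: eq_bigr => k _; rewrite all_T.
  rewrite negb_forall => /existsP[k imk].
  by rewrite (bigD1 k)//= (negbTE imk) mul0r mulr0.
under eq_bigr do rewrite bigA_distr_big_dep big_distrr/= big_mkcond/=.
rewrite exchange_big/= big1// => J _; rewrite -big_mkcond/=.
under eq_bigl do rewrite -boxE.
by rewrite -big_distrl/= hJ mul0r.
Qed.

(** * Generating pi-systems of the product and sample spaces *)

Section pi_space_measurability.
Context (n : nat) (d : 'I_n -> measure_display).
Context (S : forall k, measurableType (d k)).

Lemma measurable_pi_coord (k : 'I_n) :
  measurable_fun setT (fun x : pi_space S => x k).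
Proof.
move=> _ A mA; rewrite setTI; apply: sub_sigma_algebra.
by exists k => //; exists A => //; rewrite setTI.
Qed.

Lemma measurable_fun_pi (d' : measure_display) (T : measurableType d')
    (f : T -> pi_space S) :
  (forall k, measurable_fun setT (fun t => f t k)) -> measurable_fun setT f.
Proof.
move=> mf; apply: (@measurability _ _ _ _ _ _
  (\bigcup_(k : 'I_n) preimage_set_system setT (fun x : pi_space S => x k) measurable)) => //.
move=> _ [_ [k _ [A mA <-]] <-].
by rewrite setTI -comp_preimage; apply: mf.
Qed.

Definition rectangle (A : forall k, set (S k)) : set (pi_space S) :=
  [set x | forall k, A k (x k)].

Definition rectangles : set (set (pi_space S)) :=
  [set rectangle A | A in [set A | forall k, measurable (A k)]].

Lemma measurable_rectangle (A : forall k, set (S k)) :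
  (forall k, measurable (A k)) -> measurable (rectangle A).
Proof.
move=> mA.
have -> : rectangle A = \bigcap_(k in setT) ((fun x : pi_space S => x k) @^-1` A k).
  by apply/seteqP; split=> [x Ax k _|x Ax k]; [exact: Ax|exact: (Ax k I)].
apply: fin_bigcap_measurable; first exact: finite_finset.
move=> k _; rewrite -[X in measurable X]setTI; exact: measurable_pi_coord.
Qed.

Lemma rectangles_generate : measurable = <<s rectangles >>.
Proof.
apply/seteqP; split; last first.
  apply: smallest_sub; first exact: sigma_algebra_measurable.
  by move=> _ [A mA <-]; exact: measurable_rectangle.
move=> B mB.
have : measurable_fun setT (id : g_sigma_algebraType rectangles -> pi_space S).
  apply: measurable_fun_pi => k _ A mA; rewrite setTI.
  apply: sub_sigma_algebra.
  (* The cylinder over [A] is the rectangle with [A] as side [k] and full sides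
     elsewhere; the cast along [e] makes this dependent family well typed. *)
  exists (fun j => [set s | forall e : j = k, A (ecast j (S j) e s)]).
    move=> j /=; case: (eqVneq j k) => [->|jk].
      rewrite (_ : [set s | _] = A)//; apply/seteqP; split=> s.
        by move/(_ erefl).
      by move=> As e; rewrite eq_axiomK.
    rewrite (_ : [set s | _] = setT)//; apply/seteqP; split => // s _ e.
    by rewrite e eqxx in jk.
  apply/seteqP; split => x /=; first by move/(_ k erefl).
  by move=> Ax j e; case: _ / e A {mA} Ax.
by move/(_ measurableT B mB); rewrite setTI.
Qed.

Lemma rectangles_setI : setI_closed rectangles.
Proof.
move=> _ _ [A mA <-] [B mB <-]; exists (fun k => A k `&` B k) => [k|].
  exact: measurableI.
apply/seteqP; split=> [x AB|x [Ax Bx] k]; last by split.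
by split => k; case: (AB k).
Qed.

Lemma rectangles_setT : rectangles setT.
Proof. by exists (fun=> setT) => //; apply/seteqP. Qed.

End pi_space_measurability.

Section sample_space_measurability.
Context (K N : nat) (d : 'I_K -> measure_display).
Context (S : forall k, measurableType (d k)).

Definition boxes : set (set (N.-tuple (pi_space S))) :=
  [set [set t | forall n, rectangle (A n) (tnth t n)] | A in
    [set A : 'I_N -> forall k, set (S k) | forall n k, measurable (A n k)]].

Lemma measurable_box (A : 'I_N -> forall k, set (S k)) :
  (forall n k, measurable (A n k)) ->
  measurable [set t : N.-tuple (pi_space S) | forall n, rectangle (A n) (tnth t n)].
Proof.
move=> mA.
rewrite (_ : [set t | _] = \bigcap_(n in setT)
    ((@tnth N (pi_space S))^~ n @^-1` rectangle (A n))); last first.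
  by apply/seteqP; split=> [x Ax k _|x Ax k]; [exact: Ax|exact: (Ax k I)].
apply: fin_bigcap_measurable; first exact: finite_finset.
move=> n _; rewrite -[X in measurable X]setTI.
by apply: measurable_tnth => //; exact: measurable_rectangle.
Qed.

Lemma boxes_generate : measurable = <<s boxes >>.
Proof.
apply/seteqP; split; last first.
  apply: smallest_sub; first exact: sigma_algebra_measurable.
  by move=> _ [A mA <-]; exact: measurable_box.
move=> B mB.
have : measurable_fun setT (id : g_sigma_algebraType boxes -> N.-tuple (pi_space S)).
  apply/measurable_fun_tnthP => n.
  apply: (@measurability _ _ _ _ _ _ (@rectangles K d S)); first exact: rectangles_generate.
  move=> _ [_ [A mA <-] <-]; rewrite setTI.
  apply: sub_sigma_algebra.
  exists (fun m => if m == n then A else fun=> setT).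
    by move=> m k; case: ifP.
  apply/seteqP; split => x /=; first by move/(_ n); rewrite eqxx.
  by move=> Ax m; case: eqP => [->|].
by move/(_ measurableT B mB); rewrite setTI.
Qed.

Lemma boxes_setI : setI_closed boxes.
Proof.
move=> _ _ [A mA <-] [B mB <-]; exists (fun n k => A n k `&` B n k) => [n k|].
  exact: measurableI.
apply/seteqP; split=> [x AB|x [Ax Bx] n k]; last by split; [exact: Ax|exact: Bx].
by split => n k; case: (AB n k).
Qed.

Lemma boxes_setT : boxes setT.
Proof. by exists (fun _ _ => setT) => //; apply/seteqP. Qed.

End sample_space_measurability.

Lemma probability_unique (R : realType) (d : measure_display)
    (T : measurableType d) (G : set (set T)) (P Q : probability T R) :
  measurable = <<s G >> -> setI_closed G -> G setT ->
  (forall A, G A -> P A = Q A) -> forall A, measurable A -> P A = Q A.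
Proof.
move=> mG GI GT PQ A mA.
apply: (measure_unique G (fun=> setT)) => //.
  by rewrite bigcup_const.
by move=> k; rewrite -ge0_fin_numE// fin_num_measure.
Qed.

(** * Laws of shuffled and recombined samples *)

(** Arrays with bijective columns act by shuffling each coordinate of the sample;
    arbitrary arrays range over all the samples that can be drawn from the
    grid spanned by [t]. *)
Definition resample (K N : nat) (d : 'I_K -> measure_display)
    (S : forall k, measurableType (d k)) (t : N.-tuple (pi_space S))
    (w : {ffun 'I_N -> {ffun 'I_K -> 'I_N}}) : N.-tuple (pi_space S) :=
  [tuple recombine t (w n) | n < N].

Lemma measurable_recombine (K N : nat) (d : 'I_K -> measure_display)
    (S : forall k, measurableType (d k)) (n : {ffun 'I_K -> 'I_N}) :
  measurable_fun setT (fun t : N.-tuple (pi_space S) => recombine t n).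
Proof.
apply: measurable_fun_pi => k.
rewrite (_ : (fun t => _) = (fun x : pi_space S => x k) \o (@tnth N _ ^~ (n k)))//.
by apply: measurableT_comp; [exact: measurable_pi_coord|exact: measurable_tnth].
Qed.

Lemma measurable_resample (K N : nat) (d : 'I_K -> measure_display)
    (S : forall k, measurableType (d k)) (w : {ffun 'I_N -> {ffun 'I_K -> 'I_N}}) :
  measurable_fun setT (fun t : N.-tuple (pi_space S) => resample t w).
Proof.
apply/measurable_fun_tnthP => n.
rewrite (_ : _ \o _ = (fun t => recombine t (w n))).
  exact: measurable_recombine.
by apply/funext => t /=; rewrite tnth_mktuple.
Qed.

Lemma measurable_estimator (R : realType) (K N : nat)
    (d : 'I_K -> measure_display) (S : forall k, measurableType (d k))
    (phi : pi_space S -> R) :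
  measurable_fun setT phi ->
  measurable_fun setT (product_form_estimator phi : N.-tuple (pi_space S) -> R).
Proof.
move=> mphi; apply: measurable_funM => //.
apply: measurable_sum => n.
by apply: measurableT_comp => //; exact: measurable_recombine.
Qed.

Section iid_sample.
Context (R : realType) (K N : nat) (d : 'I_K -> measure_display).
Context (S : forall k, measurableType (d k)).
Context (dO : measure_display) (Omega : measurableType dO).
Context (P : probability Omega R) (X : 'I_N -> {RV P >-> pi_space S}).
Context (mu : probability (pi_space S) R) (Xmu : iid X mu).

Lemma tnth_sample o n : tnth (sample X o) n = X n o.
Proof. exact: tnth_mktuple. Qed.

Lemma measurable_sample : measurable_fun setT (sample X).
Proof.
apply/measurable_fun_tnthP => n.
rewrite (_ : _ \o _ = X n) //.
by apply/funext => w /=; rewrite tnth_mktuple.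
Qed.

HB.instance Definition _ :=
  isMeasurableFun.Build _ _ _ _ (sample X) measurable_sample.

Context (mu_ : forall k, probability (S k) R).
Hypothesis mu_prod : forall A : (forall k, set (S k)),
  (forall k, measurable (A k)) -> mu (rectangle A) = (\prod_(k < K) mu_ k (A k))%E.

(** Independence of the sample points and the product form of their common law
    combine into independence of all the N * K coordinates. *)
Lemma sample_box (A : 'I_N -> forall k, set (S k)) :
  (forall n k, measurable (A n k)) ->
  P [set w | forall n, rectangle (A n) (X n w)]
    = (\prod_(n < N) \prod_(k < K) mu_ k (A n k))%E.
Proof.
move=> mA; have [indep law] := Xmu.
have mR n : measurable (rectangle (A n)) by exact: measurable_rectangle.
have := indep finset.setT (fun n => rectangle (A n)) mR.
rewrite (_ : \bigcap_(_ in _) _ = [set w | forall n, rectangle (A n) (X n w)]); last first.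
  apply/seteqP; split=> [w Aw n|w Aw n _]; last exact: Aw.
  by apply: Aw => /=; rewrite inE.
move=> ->; apply: eq_big => [n|n _]; first by rewrite inE.
by rewrite -mu_prod//; exact: law.
Qed.

(** Both laws give a box the product of the masses of its sides, in two orders;
    boxes form a generating pi-system. *)
Lemma resample_law (w : {ffun 'I_N -> {ffun 'I_K -> 'I_N}}) :
  column_bijective w -> forall B, measurable B ->
  P ((fun o => resample (sample X o) w) @^-1` B) = P (sample X @^-1` B).
Proof.
move=> wbij B mB.
pose Y o := resample (sample X o) w.
have mY : measurable_fun setT Y.
  by apply: (measurableT_comp (measurable_resample w)); exact: measurable_sample.
pose Y' : {RV P >-> N.-tuple (pi_space S)} := HB.pack Y (isMeasurableFun.Build _ _ _ _ Y mY).
pose X' : {RV P >-> N.-tuple (pi_space S)} := sample X.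
suff : distribution P Y' B = distribution P X' B by [].
move: B mB; apply: (probability_unique (@boxes_generate K N d S)).
- exact: boxes_setI.
- exact: boxes_setT.
move=> _ [A mA <-].
have winj k : injective (fun n => w n k) by apply/injectiveP/(forallP wbij).
pose A' m k := A (invF (@winj k) m) k.
transitivity (P [set o | forall m, rectangle (A' m) (X m o)]).
  congr (P _); apply/seteqP; split => o /= Ao.
    move=> m k; have := Ao (invF (@winj k) m) k.
    by rewrite tnth_mktuple /recombine tnth_sample (f_invF (@winj k)).
  move=> n k; rewrite tnth_mktuple /recombine tnth_sample.
  by have := Ao (w n k) k; rewrite /A' (invF_f (@winj k)).
rewrite sample_box//; last by move=> m k; exact: mA.
transitivity (P [set o | forall m, rectangle (A m) (X m o)]); last first.
  congr (P _); apply/seteqP; split => o /= Ao n.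
    by have := Ao n; rewrite -tnth_sample.
  by have := Ao n; rewrite -[X n o]tnth_sample.
rewrite sample_box// exchange_big [RHS]exchange_big/=; apply: eq_bigr => k _.
rewrite (reindex_inj (@winj k))/=; apply: eq_bigr => n _.
by rewrite /A' (invF_f (@winj k)).
Qed.

(** Each coordinate of the recombined point is drawn from its own marginal,
    independently of the others even if two of them come from the same sample
    point.  This is where the product form of [mu] makes the estimator
    unbiased. *)
Lemma recombine_law (n : {ffun 'I_K -> 'I_N}) B : measurable B ->
  P ((fun o => recombine (sample X o) n) @^-1` B) = mu B.
Proof.
move=> mB.
pose Y o := recombine (sample X o) n.
have mY : measurable_fun setT Y.
  by apply: (measurableT_comp (measurable_recombine n)); exact: measurable_sample.
pose Y' : {RV P >-> pi_space S} := HB.pack Y (isMeasurableFun.Build _ _ _ _ Y mY).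
suff : distribution P Y' B = mu B by [].
move: B mB; apply: (probability_unique (@rectangles_generate K d S)).
- exact: rectangles_setI.
- exact: rectangles_setT.
move=> _ [A mA <-].
(* The event constrains coordinate [k] of the sample point [n k] only. *)
pose A' m k := if n k == m then A k else setT.
have mA' m k : measurable (A' m k) by rewrite /A'; case: ifP.
transitivity (P [set o | forall m, rectangle (A' m) (X m o)]).
  congr (P _); apply/seteqP; split => o /= Ao.
    move=> m k; have := Ao k; rewrite /Y /recombine tnth_sample /A'.
    by case: eqP => [->|].
  move=> k; rewrite /Y /recombine tnth_sample.
  by have := Ao (n k) k; rewrite /A' eqxx.
rewrite sample_box// mu_prod// exchange_big/=; apply: eq_bigr => k _.
rewrite (bigD1 (n k))//= /A' eqxx big1 ?mule1// => m mn.
by rewrite eq_sym (negbTE mn) probability_setT.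
Qed.

End iid_sample.

(** * Uniform laws on finite families of points *)

Section finite_uniform.
Context (R : realType) (dT : measure_display) (T : measurableType dT).
Context (I : finType) (D : {pred I}) (y : I -> T).

Definition counting_on : {measure set T -> \bar R} :=
  msum (fun m => \d_(nth point [seq y i | i <- enum D] m)) #|D|.

(** Normalising makes this a probability for every [D]; for an empty [D] it is
    the Dirac mass at the default point. *)
Definition uniform_on : probability T R := mnormalize counting_on \d_point.

Hypothesis D0 : (0 < #|D|)%N.

Let sum_enum (V : nmodType) (g : T -> V) :
  \sum_(m < #|D|) g (nth point [seq y i | i <- enum D] m) = \sum_(i in D) g (y i).
Proof.
rewrite -(big_mkord xpredT (fun m => g (nth point [seq y i | i <- enum D] m))).
rewrite cardE -(size_map y) -(big_nth point xpredT g) big_map.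
by rewrite big_enum.
Qed.

Let counting_onE A : counting_on A = (\sum_(i in D) \1_A (y i))%:E.
Proof.
rewrite -sumEFin -(sum_enum (fun x => (\1_A x)%:E)).
by rewrite /counting_on /= /msum; apply: eq_bigr.
Qed.

Lemma uniform_onE A :
  uniform_on A = (#|D|%:R^-1 * \sum_(i in D) \1_A (y i))%:E.
Proof.
rewrite /uniform_on /= /mnormalize !counting_onE.
rewrite (eq_bigr (fun=> 1)) => [|i _]; last by rewrite indicT.
rewrite sumr_const/= eqe pnatr_eq0 -[X in X || _]negbK -lt0n D0/=.
by rewrite -[msum _ _ A]/(counting_on A) counting_onE mulrC EFinM.
Qed.

Lemma ge0_integral_uniform_on (g : T -> \bar R) :
  measurable_fun setT g -> (forall x, 0 <= g x)%E ->
  (\int[uniform_on]_x g x = (#|D|%:R^-1)%:E * \sum_(i in D) g (y i))%E.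
Proof.
move=> mg g0.
have D1 : (0 <= #|D|%:R^-1 :> R) by rewrite invr_ge0.
rewrite (eq_measure_integral (mscale (NngNum D1) counting_on)); last first.
  by move=> A _ _; rewrite /= /mscale/= uniform_onE counting_onE.
rewrite ge0_integral_mscale//=; congr (_ * _)%E.
rewrite /counting_on ge0_integral_measure_sum//= -(sum_enum g).
by apply: eq_bigr => m _; rewrite integral_dirac// diracT mul1e.
Qed.

Lemma integrable_uniform_on (g : T -> R) :
  measurable_fun setT g -> uniform_on.-integrable setT (EFin \o g).
Proof.
move=> mg; apply/integrableP; split; first exact/measurable_EFinP.
rewrite ge0_integral_uniform_on//=; last first.
  by do 2 apply: measurableT_comp => //.
by rewrite sumEFin -EFinM ltry.
Qed.

Lemma integral_uniform_on (g : T -> R) :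
  measurable_fun setT g ->
  (\int[uniform_on]_x (g x)%:E)%E = (#|D|%:R^-1 * \sum_(i in D) g (y i))%:E.
Proof.
move=> mg; have mEg : measurable_fun setT (EFin \o g) by exact/measurable_EFinP.
rewrite integralE ge0_integral_uniform_on//; last exact: measurable_funepos.
rewrite ge0_integral_uniform_on//; last exact: measurable_funeneg.
rewrite (eq_bigr (fun i => (Num.max (g (y i)) 0)%:E)) => [|i _]; last first.
  by rewrite funeposE -EFin_max.
rewrite [X in (_ - _ * X)%E](eq_bigr (fun i => (Num.max (- g (y i)) 0)%:E)) => [|i _]; last first.
  by rewrite funenegE -EFin_max.
rewrite !sumEFin -!EFinM -EFinB -mulrBr -sumrB; congr (_ * _)%:E.
apply: eq_bigr => i _.
by case: (lerP (g (y i)) 0) => h; case: (lerP (- g (y i)) 0) => h'; lra.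
Qed.
End finite_uniform.

(** * Product-form laws on finite grids *)

(** Independence of the components of a uniformly drawn function. *)
Lemma average_family (R : realFieldType) (I M : finType) (D : I -> {pred M})
    (g : I -> M -> R) :
  #|family D|%:R^-1 * \sum_(w in family D) \prod_i g i (w i)
    = \prod_i (#|D i|%:R^-1 * \sum_(j in D i) g i j).
Proof.
rewrite big_split/= prodfV bigA_distr_big_dep; congr (_^-1 * _).
under [RHS]eq_bigr do rewrite -sumr_const.
rewrite bigA_distr_big_dep/= -sumr_const; apply: eq_bigr => w _.
by rewrite big1.
Qed.

Lemma card_family_gt0 (I M : finType) (D : I -> {pred M}) :
  (forall i, 0 < #|D i|)%N -> (0 < #|family D|)%N.
Proof.
move=> D0; apply/card_gt0P.
have ex i : exists j, j \in D i by exact/card_gt0P.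
by exists [ffun i => xchoose (ex i)]; apply/familyP => i; rewrite ffunE; exact: xchooseP.
Qed.

Lemma indic_rectangle (R : realType) (K : nat) (d : 'I_K -> measure_display)
    (S : forall k, measurableType (d k)) (A : forall k, set (S k)) (x : pi_space S) :
  \1_(rectangle A) x = \prod_k \1_(A k) (x k) :> R.
Proof.
have [xA|xA] := pselect (rectangle A x).
  rewrite indicE mem_set// big1// => k _.
  by rewrite indicE mem_set//; exact: xA.
have [k Akx] : exists k, ~ A k (x k) by exact/existsNP.
by rewrite indicE memNset// (bigD1 k)//= indicE memNset// mul0r.
Qed.

Section grid.
Context (R : realType) (K N : nat) (d : 'I_K -> measure_display).
Context (S : forall k, measurableType (d k)) (x : N.-tuple (pi_space S)).
Context (J : 'I_K -> {set 'I_N}).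
Hypothesis J0 : forall k, J k != finset.set0.

Definition index_grid : {pred {ffun 'I_K -> 'I_N}} := family (fun k => mem (J k)).

Definition grid_law : probability (pi_space S) R :=
  uniform_on R index_grid (recombine x).

Definition sample_grid : {pred {ffun 'I_N -> {ffun 'I_K -> 'I_N}}} :=
  family (fun _ : 'I_N => mem index_grid).

Definition grid_sample_law : probability (N.-tuple (pi_space S)) R :=
  uniform_on R sample_grid (resample x).

Lemma sample_gridE w : (w \in sample_grid) = [forall n, forall k, w n k \in J k].
Proof. by []. Qed.

Lemma index_grid_gt0 : (0 < #|index_grid|)%N.
Proof. by apply: card_family_gt0 => k; rewrite card_gt0. Qed.

Lemma sample_grid_gt0 : (0 < #|sample_grid|)%N.
Proof. by apply: card_family_gt0 => _; exact: index_grid_gt0. Qed.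

(** Drawing a point of the grid uniformly amounts to drawing its coordinates
    independently and uniformly. *)
Lemma grid_law_product_form : product_form grid_law.
Proof.
exists (fun k => uniform_on R (mem (J k)) (fun j => tnth x j k)) => A mA.
have := average_family (fun k => mem (J k)) (fun k j => \1_(A k) (tnth x j k) : R).
rewrite -[[set _ | _]]/(rectangle A) /grid_law uniform_onE ?index_grid_gt0//.
move=> avg.
under eq_bigr do rewrite indic_rectangle.
rewrite avg -prodEFin; apply: eq_bigr => k _.
by rewrite uniform_onE// card_gt0.
Qed.

Definition coordinate (n : 'I_N) (t : N.-tuple (pi_space S)) := tnth t n.

HB.instance Definition _ (n : 'I_N) := isMeasurableFun.Build _ _ _ _
  (coordinate n) (measurable_tnth n).

(** The canonical realisation: the sample space itself carries the law, which is
    uniform on the samples drawn from the grid. *)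
Definition grid_sample (n : 'I_N) : {RV grid_sample_law >-> pi_space S} :=
  coordinate n.

Lemma sample_grid_sample : sample grid_sample = id.
Proof. by apply/funext => t; apply: eq_from_tnth => n; rewrite tnth_mktuple. Qed.

Lemma grid_sample_iid : iid grid_sample grid_law.
Proof.
have indep (L : {set 'I_N}) (A : 'I_N -> set (pi_space S)) :
    grid_sample_law (\bigcap_(n in [set` L]) (grid_sample n @^-1` A n))
    = (\prod_(n in L) grid_law (A n))%E.
  rewrite /grid_sample_law uniform_onE ?sample_grid_gt0//.
  rewrite (eq_bigr (fun w : {ffun 'I_N -> {ffun 'I_K -> 'I_N}} => \prod_n
     (if n \in L then \1_(A n) (recombine x (w n)) else 1))); last first.
    move=> w _; rewrite -big_mkcond/=.
    have [wA|wA] := pselect (forall n, n \in L -> A n (recombine x (w n))).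
      rewrite indicE mem_set; last by move=> n nL /=; rewrite /coordinate tnth_mktuple; exact: wA.
      by rewrite big1// => n nL; rewrite indicE mem_set//; exact: wA.
    rewrite indicE memNset => [|wA']; last first.
      by apply: wA => n nL; have := wA' n nL; rewrite /= /coordinate tnth_mktuple.
    have [n /not_implyP[nL wAn]] : exists n, ~ (n \in L -> A n (recombine x (w n))).
      exact/existsNP.
    by rewrite (bigD1 n)//= indicE memNset// mul0r.
  rewrite (average_family (fun=> mem index_grid) (fun n v =>
     if n \in L then \1_(A n) (recombine x v) else 1)) -prodEFin [RHS]big_mkcond/=.
  apply: eq_bigr => n _; case: ifP => nL.
    by rewrite /grid_law uniform_onE ?index_grid_gt0.
  by rewrite sumr_const mulVf// pnatr_eq0 -lt0n index_grid_gt0.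
have law n A : grid_sample_law (grid_sample n @^-1` A) = grid_law A.
  have := indep [set n]%SET (fun=> A); rewrite big_set1 => <-; congr (grid_sample_law _).
  apply/seteqP; split => t /=.
    by move=> At m /=; rewrite inE => /eqP->.
  by move=> /(_ n); apply; rewrite /= inE.
split=> [L A mA|n A mA]; last exact: law.
by rewrite indep; apply: eq_bigr => n _; rewrite law.
Qed.

End grid.

(** * Unbiasedness and symmetry of the estimator *)

Section transfer_along_a_law.
Context (R : realType) (dO dT : measure_display).
Context (Omega : measurableType dO) (T : measurableType dT).
Context (P : probability Omega R) (mu : probability T R) (Y : Omega -> T).
Hypothesis mY : measurable_fun setT Y.
Hypothesis lawY : forall B, measurable B -> P (Y @^-1` B) = mu B.

Let RVY : {RV P >-> T} := HB.pack Y (isMeasurableFun.Build _ _ _ _ Y mY).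

Lemma ge0_integral_law (g : T -> \bar R) :
  measurable_fun setT g -> (forall y, 0 <= g y)%E ->
  (\int[P]_o g (Y o) = \int[mu]_y g y)%E.
Proof.
move=> mg g0; rewrite -(ge0_integral_distribution RVY mg g0).
by apply: eq_measure_integral => B mB _; exact: lawY.
Qed.

Lemma integrable_law (g : T -> \bar R) :
  mu.-integrable setT g -> P.-integrable setT (g \o Y).
Proof.
move=> /integrableP[mg goo]; apply/integrableP; split.
  exact: measurableT_comp.
rewrite (ge0_integral_law (g := abse \o g))// => [|y]; last exact: abse_ge0.
exact: measurableT_comp.
Qed.

Lemma integral_law (g : T -> \bar R) :
  mu.-integrable setT g -> (\int[P]_o g (Y o) = \int[mu]_y g y)%E.
Proof.
move=> ig; have mg := measurable_int _ ig.
rewrite -(integral_distribution (X := RVY) mg (integrable_law ig)).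
by apply: eq_measure_integral => B mB _; exact: lawY.
Qed.

End transfer_along_a_law.

Lemma estimator_unbiased (R : realType) (K N : nat) (d : 'I_K -> measure_display)
    (S : forall k, measurableType (d k)) (phi : pi_space S -> R)
    (mu : probability (pi_space S) R) (dO : measure_display)
    (Omega : measurableType dO) (P : probability Omega R)
    (X : 'I_N -> {RV P >-> pi_space S}) :
  (0 < N)%N -> measurable_fun setT phi ->
  product_form mu -> (\int[mu]_x `|phi x|%:E < +oo)%E -> iid X mu ->
  P.-integrable setT (EFin \o (product_form_estimator phi \o sample X)) /\
  'E_P[product_form_estimator phi \o sample X]%E = (\int[mu]_x (phi x)%:E)%E.
Proof.
move=> N0 mphi [mu_ mu_prod] phioo Xmu.
have iphi : mu.-integrable setT (EFin \o phi).
  by apply/integrableP; split => //; exact/measurable_EFinP.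
have mrec n : measurable_fun setT (fun o => recombine (sample X o) n).
  apply: (measurableT_comp (@measurable_recombine K N d S n)).
  exact: measurable_sample.
have law n := recombine_law Xmu mu_prod n.
have irec n : P.-integrable setT (fun o => (phi (recombine (sample X o) n))%:E).
  exact: (integrable_law (mrec n) (law n) iphi).
have estE o : (product_form_estimator phi (sample X o))%:E =
    ((N%:R ^+ K)^-1%:E *
     \sum_(n : {ffun 'I_K -> 'I_N}) (phi (recombine (sample X o) n))%:E)%E.
  by rewrite sumEFin -EFinM.
have isum : P.-integrable setT (fun o => \sum_(n : {ffun 'I_K -> 'I_N})
    (phi (recombine (sample X o) n))%:E)%E.
  exact: integrable_sum.
have -> : EFin \o (product_form_estimator phi \o sample X) = fun o =>
    ((N%:R ^+ K)^-1%:E *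
     \sum_(n : {ffun 'I_K -> 'I_N}) (phi (recombine (sample X o) n))%:E)%E.
  by apply/funext => o; exact: estE.
split; first exact: integrableZl.
rewrite unlock; under eq_integral do rewrite /= estE.
rewrite integralZl// integral_sum//.
rewrite (eq_bigr (fun=> \int[mu]_x (phi x)%:E)%E); last first.
  by move=> n _; exact: (integral_law (mrec n) (law n) iphi).
have : (\int[mu]_x (phi x)%:E)%E \is a fin_num by exact: integrable_fin_num.
move=> /fineK <-; rewrite sumEFin -EFinM sumr_const card_ffun !card_ord.
by rewrite -[X in _ * X]mulr_natl natrX mulKf// expf_neq0// pnatr_eq0 -lt0n.
Qed.

(** Shuffling the coordinates permutes the recombined points over which the
    estimator averages. *)
Lemma estimator_resample (R : realType) (K N : nat) (d : 'I_K -> measure_display)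
    (S : forall k, measurableType (d k)) (phi : pi_space S -> R)
    (t : N.-tuple (pi_space S)) (w : {ffun 'I_N -> {ffun 'I_K -> 'I_N}}) :
  column_bijective w ->
  product_form_estimator phi (resample t w) = product_form_estimator phi t.
Proof.
move=> /forallP wbij; rewrite /product_form_estimator; congr (_ * _).
pose h (n : {ffun 'I_K -> 'I_N}) := [ffun k => w (n k) k] : {ffun 'I_K -> 'I_N}.
have hinj : injective h.
  move=> n n' /ffunP hnn'; apply/ffunP => k.
  by have := hnn' k; rewrite !ffunE => /(injectiveP _ (wbij k)).
rewrite [RHS](reindex_inj hinj)/=; apply: eq_bigr => n _; congr phi.
by apply: functional_extensionality_dep => k; rewrite /recombine tnth_mktuple ffunE.
Qed.

(** * Symmetrised unbiased statistics *)

(** Unbiasedness is only used under the laws of grids spanned by sample points.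
    Such a law turns the two expectations into finite sums, and
    [sum_column_bijective] applies to the difference of [f] and the estimator. *)
Lemma estimator_is_average (R : realType) (K N : nat)
    (d : 'I_K -> measure_display) (S : forall k, measurableType (d k))
    (phi : pi_space S -> R) (f : N.-tuple (pi_space S) -> R) :
  (0 < N)%N -> measurable_fun setT phi -> measurable_fun setT f ->
  (forall (x : N.-tuple (pi_space S)) (J : 'I_K -> {set 'I_N}),
    (forall k, J k != finset.set0) ->
    'E_(grid_sample_law R x J)[f \o sample (grid_sample R x J)]%E
      = (\int[grid_law R x J]_z (phi z)%:E)%E) ->
  forall t, product_form_estimator phi t
    = #|@column_bijective 'I_K 'I_N|%:R^-1
        * \sum_(w | column_bijective w) f (resample t w).
Proof.
move=> N0 mphi mf unbiased t.
have bij0 := column_bijective_gt0 'I_K 'I_N.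
have : \sum_(w | column_bijective w)
    (f (resample t w) - product_form_estimator phi (resample t w)) = 0.
  apply: sum_column_bijective; first by rewrite card_ord.
  move=> J J0; have mT := measurable_estimator (N := N) mphi.
  have phioo : (\int[grid_law R t J]_z `|phi z|%:E < +oo)%E.
    have /integrableP[_] := integrable_uniform_on (recombine t) (index_grid_gt0 J0) mphi.
    by [].
  have [_] := estimator_unbiased N0 mphi (grid_law_product_form R t J0) phioo
    (grid_sample_iid R t J0).
  rewrite -unbiased// sample_grid_sample unlock !compE.
  rewrite (integral_uniform_on _ (sample_grid_gt0 J0) mT).
  rewrite (integral_uniform_on _ (sample_grid_gt0 J0) mf) => -[].
  have c0 : (#|sample_grid J|%:R^-1 : R) != 0.
    by rewrite invr_eq0 pnatr_eq0 -lt0n sample_grid_gt0.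
  move/(mulfI c0) => eq_sums; rewrite sumrB.
  rewrite (eq_bigl (mem (sample_grid J))); last by move=> w; rewrite -sample_gridE.
  rewrite [X in _ - X](eq_bigl (mem (sample_grid J))); last by move=> w; rewrite -sample_gridE.
  by rewrite eq_sums subrr.
rewrite sumrB => /subr0_eq ->.
rewrite (eq_bigr (fun=> product_form_estimator phi t)); last first.
  by move=> w; exact: estimator_resample.
by rewrite sumr_const -[X in _ * X]mulr_natl mulKf// pnatr_eq0 -lt0n.
Qed.

(** * Averaging over shuffles reduces the variance *)

Lemma sqr_average_le (R : realFieldType) (I : finType) (D : pred I) (a : I -> R) :
  (0 < #|D|)%N ->
  (#|D|%:R^-1 * \sum_(i | D i) a i) ^+ 2 <= #|D|%:R^-1 * \sum_(i | D i) a i ^+ 2.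
Proof.
move=> D0; set n : R := #|D|%:R; set m := n^-1 * _.
have n0 : 0 < n by rewrite ltr0n.
have sa : \sum_(i | D i) a i = n * m by rewrite /m mulVKf// gt_eqF.
have : 0 <= \sum_(i | D i) (a i - m) ^+ 2 by apply: sumr_ge0 => i _; exact: sqr_ge0.
under eq_bigr do rewrite sqrrB.
rewrite big_split/= sumrB sumrMnl -mulr_suml sa sumr_const -[m ^+ 2 *+ _]mulr_natl -/n => h.
rewrite -(ler_pM2l n0) mulVKf ?gt_eqF//; nra.
Qed.

(** The square of a deviation of [g] is at most the average of the squares of the
    deviations of the shuffled [f], all of which have the same integral.  As only
    integrals of nonnegative functions occur, infinite variances are covered. *)
Lemma variance_average_le (R : realType) (K N : nat)
    (d : 'I_K -> measure_display) (S : forall k, measurableType (d k))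
    (mu : probability (pi_space S) R) (dO : measure_display)
    (Omega : measurableType dO) (P : probability Omega R)
    (X : 'I_N -> {RV P >-> pi_space S})
    (f g : N.-tuple (pi_space S) -> R) :
  product_form mu -> iid X mu -> measurable_fun setT f -> measurable_fun setT g ->
  (forall t, g t = #|@column_bijective 'I_K 'I_N|%:R^-1
        * \sum_(w | column_bijective w) f (resample t w)) ->
  'E_P[g \o sample X]%E = 'E_P[f \o sample X]%E ->
  ('V_P[g \o sample X] <= 'V_P[f \o sample X])%E.
Proof.
move=> [mu_ mu_prod] Xmu mf mg gE.
rewrite /variance covariance.unlock => ->; set c := fine _.
have bij0 := column_bijective_gt0 'I_K 'I_N.
set q := #|_|%:R^-1 in gE.
have q0 : 0 <= q by rewrite invr_ge0.
have msq (h : N.-tuple (pi_space S) -> R) : measurable_fun setT h ->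
    measurable_fun setT (fun t : N.-tuple (pi_space S) => ((h t - c) ^+ 2)%:E).
  move=> mh; apply/measurable_EFinP.
  by apply: measurable_funX; exact: measurable_funB.
have mX := measurable_sample X.
have mXw w := measurableT_comp (@measurable_resample K N d S w) mX.
have invariant w : column_bijective w ->
    (\int[P]_o ((f (resample (sample X o) w) - c) ^+ 2)%:E
     = \int[P]_o ((f (sample X o) - c) ^+ 2)%:E)%E.
  move=> wbij.
  pose X' : {RV P >-> N.-tuple (pi_space S)} := sample X.
  have lawXw B : measurable B ->
      P ((fun o => resample (sample X o) w) @^-1` B) = distribution P X' B.
    exact: (resample_law Xmu mu_prod wbij).
  have sq0 (t : N.-tuple (pi_space S)) : (0 <= ((f t - c) ^+ 2)%:E)%E.
    by rewrite lee_fin sqr_ge0.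
  rewrite (ge0_integral_law (mXw w) lawXw (msq f mf) sq0).
  exact: (ge0_integral_distribution X' (msq f mf) sq0).
rewrite unlock.
have sqE (h : N.-tuple (pi_space S) -> R) :
    (\int[P]_o ((((h \o sample X) \- cst c) * ((h \o sample X) \- cst c)) o)%:E
     = \int[P]_o ((h (sample X o) - c) ^+ 2)%:E)%E.
  by apply: eq_integral => o _; rewrite expr2.
rewrite !sqE.
pose sum_sq o := (\sum_(w <- enum (@column_bijective 'I_K 'I_N))
  ((f (resample (sample X o) w) - c) ^+ 2)%:E)%E.
have msum_sq : measurable_fun setT sum_sq.
  apply: emeasurable_sum => w.
  exact: (measurableT_comp (msq f mf) (mXw w)).
have sum_sq0 o : (0 <= sum_sq o)%E.
  by apply: sume_ge0 => w _; rewrite lee_fin sqr_ge0.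
have -> : (\int[P]_o ((f (sample X o) - c) ^+ 2)%:E
    = \int[P]_o (q%:E * sum_sq o))%E.
  rewrite ge0_integralZl// ge0_integral_sum//; last 2 first.
  - by move=> w; exact: (measurableT_comp (msq f mf) (mXw w)).
  - by move=> w o _; rewrite lee_fin sqr_ge0.
  rewrite big_enum/= (eq_bigr (fun=> 1%:E * \int[P]_o ((f (sample X o) - c) ^+ 2)%:E)%E) => [|w]; last first.
    by move=> wbij; rewrite mul1e; exact: invariant.
  rewrite -ge0_sume_distrl ?sumEFin ?sumr_const// muleA -EFinM mulVf ?mul1e//.
  by rewrite pnatr_eq0 -lt0n.
apply: ge0_le_integral => //.
- by move=> o _; rewrite lee_fin sqr_ge0.
- exact: (measurableT_comp (msq g mg) mX).
- exact: measurable_funeM.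
move=> o _; rewrite /sum_sq big_enum/= sumEFin -EFinM lee_fin.
have -> : g (sample X o) - c = q * \sum_(w | @column_bijective 'I_K 'I_N w) (f (resample (sample X o) w) - c).
  rewrite gE sumrB mulrBr; congr (_ - _).
  by rewrite sumr_const -[X in _ * X]mulr_natl mulKf// pnatr_eq0 -lt0n.
exact: sqr_average_le.
Qed.

Theorem theorem2 (R : realType) (K : nat) (hK : (1 < K)%N)
    (d : 'I_K -> measure_display) (S : forall k, measurableType (d k))
    (phi : pi_space S -> R) (mphi : measurable_fun setT phi)
    (N : nat) (hN : (0 < N)%N)
    (f : N.-tuple (pi_space S) -> R) (mf : measurable_fun setT f)
    (unbiased_f : forall mu : probability (pi_space S) R,
      product_form mu -> (\int[mu]_x `|phi x|%:E < +oo)%E ->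
      forall (dO : measure_display) (Omega : measurableType dO)
        (P : probability Omega R) (X : 'I_N -> {RV P >-> pi_space S}),
      iid X mu ->
      P.-integrable setT (EFin \o (f \o sample X)) /\
      'E_P[f \o sample X]%E = (\int[mu]_x (phi x)%:E)%E) :
  forall mu : probability (pi_space S) R,
    product_form mu -> (\int[mu]_x `|phi x|%:E < +oo)%E ->
    forall (dO : measure_display) (Omega : measurableType dO)
      (P : probability Omega R) (X : 'I_N -> {RV P >-> pi_space S}),
    iid X mu ->
    ('V_P[product_form_estimator phi \o sample X] <= 'V_P[f \o sample X])%E.
Proof.
move=> mu mu_prod phioo dO Omega P X Xmu.
have [_ Ef] := unbiased_f mu mu_prod phioo _ _ _ _ Xmu.
have [_ ET] := estimator_unbiased hN mphi mu_prod phioo Xmu.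
apply: (variance_average_le mu_prod Xmu mf (measurable_estimator mphi)).
- apply: estimator_is_average => // x J J0.
  have phioo_grid : (\int[grid_law R x J]_z `|phi z|%:E < +oo)%E.
    by have /integrableP[] :=
      integrable_uniform_on (recombine x) (index_grid_gt0 J0) mphi.
  exact: (unbiased_f _ (grid_law_product_form R x J0) phioo_grid _ _ _ _
    (grid_sample_iid R x J0)).2.
- by rewrite ET Ef.
Qed.
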